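(* For any finite union $X=\bigcup_{i\in I}L_i$ of affine subspaces $L_i$ of a finite-dimensional real vector space $L$, there exists a good triangulation of $X$.
   Context: For $x\in X$ let $I(x)=\{i\in I: x\in L_i\}$. A good triangulation of $X=\bigcup_{i\in I}L_i$ is a triangulation such that the set of vertices of every simplex $S$ of it is totally ordered in the following sense: the vertices of $S$ can be ordered as $v_{1},\ldots,v_{s}$ so that $I(v_{1})\subset\cdots\subset I(v_{s})$. *)

(* Defs.v *)
From HB Require Import structures.
From mathcomp Require Import all_boot all_order all_algebra.
From mathcomp Require Import finmap.
From mathcomp Require Import all_classical all_reals all_analysis.

Set Implicit Arguments.
Unset Strict Implicit.
Unset Printing Implicit Defensive.

Import Order.TTheory GRing.Theory Num.Theory.
Import numFieldNormedType.Exports.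

Local Open Scope classical_set_scope.
Local Open Scope ring_scope.

Section Triangulations.
Context {R : realType} {L : vectType R}.

Definition affine_subspace (A : set L) : Prop :=
  exists p : L, exists V : {vspace L}, A = [set x | x - p \in V].

(* [vectType] carries no topology: this is the usual topology of a
   finite-dimensional real vector space, transported from R^n along the linear
   isomorphism [r2v]; it does not depend on that isomorphism. *)
Definition vclosed (C : set L) : Prop :=
  closed ((@VectorInternalTheory.r2v R L) @^-1` C).

(* [A] is closed in the subspace topology of [Y]. *)
Definition closed_in (Y A : set L) : Prop :=
  exists2 C : set L, vclosed C & A = C `&` Y.

(* Simplices are encoded by their finite sets of vertices. *)
Definition affinely_independent (s : {fset L}) : Prop :=
  forall a : L -> R,
    \sum_(v <- s) a v = 0 -> \sum_(v <- s) a v *: v = 0 ->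
    forall v : L, v \in s -> a v = 0.

Definition convex_hull (s : {fset L}) : set L :=
  [set x | exists a : L -> R,
     [/\ forall v : L, v \in s -> 0 <= a v,
         \sum_(v <- s) a v = 1 &
         x = \sum_(v <- s) a v *: v]].

(* In [meet], [u] may be empty, and then [convex_hull u] is empty: two
   simplices are either disjoint or meet along a common face. *)
Record simplicial_complex (K : set {fset L}) : Prop := SimplicialComplex {
  complex_nonempty : forall s, K s -> s != fset0;
  complex_independent : forall s, K s -> affinely_independent s;
  complex_face : forall s t, K s -> t != fset0 -> (t `<=` s)%fset -> K t;
  complex_meet : forall s t, K s -> K t ->
    exists u : {fset L}, [/\ (u `<=` s)%fset, (u `<=` t)%fset &
      convex_hull s `&` convex_hull t = convex_hull u] }.

Definition polyhedron (K : set {fset L}) : set L :=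
  \bigcup_(s in K) convex_hull s.

(* The complex may be infinite, as it must be when [X] is unbounded. The space
   |K| has the weak topology, in which a set is closed iff its trace on every
   simplex is; the last condition says that this is the topology [X] inherits
   from [L]. It makes [K] locally finite, and excludes for instance the set of
   all points of [X] taken as 0-simplices. *)
Record triangulation (X : set L) (K : set {fset L}) : Prop := Triangulation {
  triangulation_complex : simplicial_complex K;
  triangulation_support : polyhedron K = X;
  triangulation_topology : forall A : set L, A `<=` X ->
    (closed_in X A <->
     forall s, K s -> closed_in (convex_hull s) (A `&` convex_hull s)) }.

Definition indices (I : finType) (A : I -> set L) (x : L) : set I :=
  [set i | A i x].

Definition good_triangulation (I : finType) (A : I -> set L)
    (K : set {fset L}) : Prop :=
  triangulation (\bigcup_i A i) K /\
  forall s : {fset L}, K s ->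
    exists2 vs : seq L, perm_eq vs s &
      sorted (fun v w => `[< indices A v `<=` indices A w >]) vs.

End Triangulations.

(* Main.v *)
Require Import Defs.
From mathcomp Require Import all_boot all_order all_algebra.
From mathcomp Require Import finmap.
From mathcomp Require Import all_classical all_reals all_analysis.
From mathcomp Require Import zify ring lra.

Set Implicit Arguments.
Unset Strict Implicit.
Unset Printing Implicit Defensive.

Import Order.TTheory GRing.Theory Num.Theory.
Import numFieldNormedType.Exports.
Import VectorInternalTheory.

Local Open Scope classical_set_scope.
Local Open Scope ring_scope.

(** Choose finitely many affine functions [height j] on [L] that separate points
and such that each [A i] is the common zero set of some of them. The hyperplanes
[height j = k], for integers [k], cut [L] into relatively open convex cells,
which are bounded because the heights separate points, and form a locally finite
family. Each [A i] is a union of cells, and so are the faces of every cell that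
lies in it. The triangulation is the barycentric subdivision of this cell
complex, restricted to the cells inside the union of the [A i]: pick a point in
every cell, its center, and take as simplices the finite sets of centers of
cells that are totally ordered by the face relation (flags). It is good because
a face of a cell contained in [A i] is contained in [A i], so that the indices
decrease along a flag.

The face relation is [cell_le y x]: every closed half-space bounded by a grid
hyperplane that contains [x] contains [y]. Two points share a cell when this
holds both ways, so closures of cells and cells are handled without ever naming
a cell.

The combinatorics rests on [barycenter_top]: a combination with positive weights
of the vertices of a flag lies in the cell of the top vertex of the flag, so this
vertex can be recovered from the point. If two nonnegative combinations of flags
had the same total weight and the same barycenter, subtracting the minimum of
their weights would leave two combinations with disjoint supports whose top
vertices agree; so nothing is left and the weights agree
([flag_unique_weights]). This gives both affine independence and the
intersection property. Conversely [flag_cover] puts every point [x] into a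
simplex: the ray from the center of the cell of [x] through [x] leaves the cell
at a point of a proper face ([exit_point]), where strictly more heights are
integers, and induction applies.

For the topology, a neighborhood of a point on which the heights are bounded
meets only finitely many simplices ([finite_box_centers]), each of which is
closed ([closed_convex_hull]); and a set whose trace on every simplex is closed
is then locally a finite union of closed sets. *)

(** * Closedness of simplices *)

Section HullTopology.
Context {R : realType}.

Lemma sum_continuous (T : topologicalType) (V : normedModType R) (I : Type)
    (r : seq I) (F : I -> T -> V) :
  (forall i, continuous (F i)) -> continuous (fun x => \sum_(i <- r) F i x).
Proof.
move=> Fc x; elim: r => [|i r IH].
  by under eq_fun do rewrite big_nil; exact: cvg_cst.
under eq_fun do rewrite big_cons.
by apply: cvgD => //; exact: Fc.
Qed.

Lemma rV_linear_continuous k (V : normedModType R) (f : {linear 'rV[R]_k -> V}) :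
  continuous f.
Proof.
have -> : (f : _ -> _) = fun w => \sum_(i < k) w 0 i *: f (delta_mx 0 i).
  apply/funext => w; rewrite [in LHS](row_sum_delta w) linear_sum.
  by apply: eq_bigr => i _; rewrite linearZ.
apply: sum_continuous => i w.
by apply: (cvgZ (@coord_continuous R 1 k 0 i w)); exact: cvg_cst.
Qed.

(** The hull is the image of the compact standard simplex under the linear map
sending the standard basis vectors to the vertices. *)
Lemma closed_convex_hull (L : vectType R) (s : {fset L}) :
  vclosed (convex_hull s).
Proof.
pose k := size s.
pose M := \matrix_(i < k) v2r s`_i.
pose D := [set w : 'rV[R]_k | forall i, `[0, 1]%classic (w 0 i)] `&`
  (fun w : 'rV[R]_k => \sum_i w 0 i) @^-1` [set x | x = 1].
have cD : compact D.
  apply: compact_closedI.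
    by apply: (@rV_compact R k (fun=> `[0, 1]%classic)) => _; exact: segment_compact.
  apply: preimage_closed => [w _|]; last exact: closed_eq.
  by apply: sum_continuous => i; exact: coord_continuous.
rewrite /vclosed.
have -> : r2v @^-1` convex_hull s = mulmxr M @` D.
  apply/seteqP; split=> [r /= [a [a0 a1 ra]]|_ [w [w01 w1] <-]].
    have wE i : (\row_(i < k) a s`_i) 0 i = a s`_i by rewrite mxE.
    exists (\row_(i < k) a s`_i); first split=> /=.
    - move=> i; rewrite wE /= in_itv/= a0 ?mem_nth//=.
      rewrite -a1 (big_fsetD1 s`_i) ?mem_nth//= lerDl big_seq.
      by apply: sumr_ge0 => v /fsetD1P[_ /a0].
    - rewrite -a1 [RHS](big_nth 0) big_mkord.
      by apply: eq_bigr => i _; rewrite wE.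
    rewrite mulmx_sum_row -[RHS]r2vK ra.
    rewrite (big_nth 0) big_mkord linear_sum; apply: eq_bigr => i _.
    by rewrite wE rowK linearZ.
  pose a v := oapp (w 0) 0 (insub (index v s)).
  have aE (i : 'I_k) : a s`_i = w 0 i.
    by rewrite /a index_uniq ?fset_uniq// valK.
  exists a; split.
  - move=> v vs; rewrite -(nth_index 0 vs).
    have vk : (index v s < k)%N by rewrite index_mem.
    rewrite -[index v s]/(val (Ordinal vk)) aE.
    by have := w01 (Ordinal vk); rewrite /= in_itv/= => /andP[].
  - by rewrite (big_nth 0) big_mkord -w1; apply: eq_bigr => i _; rewrite aE.
  - rewrite /mulmxr mulmx_sum_row linear_sum (big_nth 0) big_mkord.
    by apply: eq_bigr => i _; rewrite aE rowK linearZ/= v2rK.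
apply: compact_closed; first exact: norm_hausdorff.
apply: continuous_compact cD; apply: continuous_subspaceT.
exact: rV_linear_continuous.
Qed.

End HullTopology.

(** * Sums with nonnegative weights *)

Section WeightedSums.
Context {R : realType} {T : choiceType}.
Implicit Types (U : {fset T}) (a g : T -> R).

Lemma weighted_sum_ge0 U a g :
  (forall v, v \in U -> 0 <= a v) ->
  (forall v, v \in U -> 0 < a v -> 0 <= g v) ->
  0 <= \sum_(v <- U) a v * g v.
Proof.
move=> a0 g0; rewrite big_seq; apply: sumr_ge0 => v vU.
have := a0 v vU; rewrite le_eqVlt => /predU1P[<-|av]; first by rewrite mul0r.
by rewrite mulr_ge0 ?g0// ltW.
Qed.

Lemma weighted_sum_gt0 U a g v :
  (forall v, v \in U -> 0 <= a v) ->
  (forall v, v \in U -> 0 < a v -> 0 <= g v) ->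
  v \in U -> 0 < a v -> 0 < g v ->
  0 < \sum_(v <- U) a v * g v.
Proof.
move=> a0 g0 vU av gv; rewrite (big_fsetD1 v)//= ltr_pwDl ?mulr_gt0//.
by apply: weighted_sum_ge0 => w /fsetD1P[_ wU]; [exact: a0|exact: g0].
Qed.

Lemma sum_gt0_witness U a : 0 < \sum_(v <- U) a v ->
  exists2 v, v \in U & 0 < a v.
Proof.
apply: contraPP => h; apply/negP; rewrite -leNgt big_seq; apply: sumr_le0.
by move=> v vU; rewrite leNgt; apply/negP => av; apply: h; exists v.
Qed.

End WeightedSums.

(** * Leaving a unit interval along a line *)

Section LineExit.
Context {R : realType}.

(** The restriction of one height to the ray from [b] through [x]. The hypotheses
say that [b] and [x] lie in the same cell of the real line cut at the integers;
being distinct, they lie in an open unit interval, and [u] is the time at which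
the ray reaches the end of this interval. *)
Lemma line_exit (b x : R) : b != x ->
  (forall k : int, (b <= k%:~R -> x <= k%:~R) /\ (k%:~R <= b -> k%:~R <= x)) ->
  (forall k : int, (x <= k%:~R -> b <= k%:~R) /\ (k%:~R <= x -> k%:~R <= b)) ->
  (forall k : int, x != k%:~R) /\
  exists2 u : R, 1 < u & (exists k : int, b + u * (x - b) = k%:~R) /\
    forall t, 1 <= t <= u -> forall k : int,
      (x <= k%:~R -> b + t * (x - b) <= k%:~R) /\
      (k%:~R <= x -> k%:~R <= b + t * (x - b)).
Proof.
move=> bx hx hb.
(* An integer is a cell by itself, so [x] would equal [b]. *)
have xN (k : int) : x != k%:~R.
  apply: contra_neq bx => xk; have [h1 h2] := hb k.
  by apply/eqP; rewrite xk eq_le h1 ?h2// xk.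
split=> //; pose m := Num.floor x.
have mx : m%:~R < x by rewrite lt_neqAle eq_sym xN floor_le.
have xm : x < (m + 1)%:~R := floorD1_gt x.
have mb : m%:~R < b by rewrite ltNge; apply/negP => /(hx m).1; rewrite leNgt mx.
have bm : b < (m + 1)%:~R.
  by rewrite ltNge; apply/negP => /(hx (m + 1)).2; rewrite leNgt xm.
have up (k : int) : x <= k%:~R -> (m + 1)%:~R <= k%:~R :> R.
  by move=> xk; rewrite ler_int lezD1 -(ltr_int R); exact: lt_le_trans xk.
have dn (k : int) : k%:~R <= x -> k%:~R <= m%:~R :> R.
  by move=> kx; rewrite ler_int -ltzD1 -(ltr_int R); exact: le_lt_trans xm.
have [lt_bx|lt_xb|/eqP] := ltgtP b x; last by rewrite (negbTE bx).
- have d0 : 0 < x - b by rewrite subr_gt0.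
  exists (((m + 1)%:~R - b) / (x - b)); first by rewrite ltr_pdivlMr//; lra.
  split; first by exists (m + 1); rewrite divfK ?gt_eqF// addrC subrK.
  move=> t /andP[t1]; rewrite ler_pdivlMr// => tu k; split=> [/up|kx]; first lra.
  by apply: (le_trans kx); nra.
- have d0 : 0 < b - x by rewrite subr_gt0.
  have dE z : z / (b - x) * (x - b) = - z.
    by rewrite -[x - b]opprB mulrN divfK ?gt_eqF.
  exists ((b - m%:~R) / (b - x)); first by rewrite ltr_pdivlMr//; lra.
  split; first by exists m; rewrite dE opprB addrC subrK.
  move=> t /andP[t1]; rewrite ler_pdivlMr// => tu k; split=> [xk|/dn]; last lra.
  by apply: le_trans xk; nra.
Qed.

End LineExit.

(** * Grid cells and their centers *)

Section GridCells.
Context {R : realType} {L : vectType R} {J : finType}.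
Variables (phi : J -> {linear L -> R^o}) (c : J -> R).
Implicit Types (x y v w : L) (s U : {fset L}) (a : L -> R).

Definition height j x : R := phi j x + c j.

Lemma height_barycenter j U a : \sum_(v <- U) a v != 0 ->
  height j ((\sum_(v <- U) a v)^-1 *: \sum_(v <- U) a v *: v) =
  (\sum_(v <- U) a v)^-1 * \sum_(v <- U) a v * height j v.
Proof.
move=> W0; rewrite /height linearZ/= linear_sum/=.
rewrite (eq_bigr _ (fun v _ => mulrDr (a v) (phi j v) (c j))) big_split/=.
rewrite -mulr_suml mulrDr mulrA mulVf// mul1r; congr (_ * _ + _).
by apply: eq_bigr => v _; rewrite linearZ.
Qed.

(** [y] lies in the closure of the grid cell of [x]. *)
Definition cell_le y x := forall j (k : int),
  (height j x <= k%:~R -> height j y <= k%:~R) /\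
  (k%:~R <= height j x -> k%:~R <= height j y).

Lemma cell_le_trans y x z : cell_le x y -> cell_le y z -> cell_le x z.
Proof.
move=> xy yz j k; have [xy1 xy2] := xy j k; have [yz1 yz2] := yz j k.
by split=> [/yz1/xy1|/yz2/xy2].
Qed.

(** An arbitrary point in the cell of [x]. The set it is chosen from depends only
on that cell, so equivalent points have equal centers. *)
Definition center x := xget 0 [set y | cell_le x y /\ cell_le y x].

Lemma centerP x : cell_le x (center x) /\ cell_le (center x) x.
Proof. by apply: (@xgetPex _ 0 [set y | cell_le x y /\ cell_le y x]); exists x. Qed.

Lemma center_eq x y : cell_le x y -> cell_le y x -> center x = center y.
Proof.
move=> xy yx; rewrite /center; congr xget; apply/seteqP; split=> z /= [h1 h2].
  by split; [exact: cell_le_trans h1|exact: cell_le_trans xy].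
by split; [exact: cell_le_trans h1|exact: cell_le_trans yx].
Qed.

(** * Flags of centers *)

Definition flag (F : set L) :=
  (forall v, F v -> center v = v) /\
  (forall v w, F v -> F w -> cell_le v w \/ cell_le w v).

Lemma sub_flag F G : G `<=` F -> flag F -> flag G.
Proof. by move=> GF [F1 F2]; split=> [v /GF/F1|v w /GF + /GF]; last exact: F2. Qed.

Lemma seq_top (s : seq L) v0 : v0 \in s ->
  (forall v w, v \in s -> w \in s -> cell_le v w \/ cell_le w v) ->
  exists2 v, v \in s & forall w, w \in s -> cell_le w v.
Proof.
elim: s v0 => // v s IH _ _ cmp.
have [->|/IH[|u us umax]] : s = [::] \/ head v s \in s.
- by case: s {IH cmp}; [left|right; rewrite mem_head].
- by exists v; rewrite ?mem_head// => w; rewrite inE => /eqP ->.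
- by move=> x y xs ys; apply: cmp; rewrite inE ?xs ?ys orbT.
have [vu|uv] := cmp v u (mem_head _ _) (mem_behead (s := v :: s) us).
  exists u; first by rewrite inE us orbT.
  by move=> w; rewrite inE => /predU1P[->//|/umax].
exists v; rewrite ?mem_head// => w; rewrite inE => /predU1P[->//|/umax wu].
exact: cell_le_trans uv.
Qed.

(** If a closed half-space bounded by a grid hyperplane contains the top vertex, it
contains every vertex, hence the barycenter. If it misses the top vertex, the
complementary closed half-space contains all vertices, with the top one in its
interior, and therefore has the barycenter in its interior too. *)
Lemma barycenter_top U a :
  (forall v, v \in U -> 0 <= a v) -> 0 < \sum_(v <- U) a v ->
  flag [set v | v \in U /\ 0 < a v] ->
  exists v, [/\ v \in U, 0 < a v &
    v = center ((\sum_(v <- U) a v)^-1 *: \sum_(v <- U) a v *: v)].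
Proof.
move=> a0 W0 [Fc Fcmp].
have [v0 v0U av0] := sum_gt0_witness W0.
have [||v] := @seq_top [seq v <- U | 0 < a v] v0.
- by rewrite mem_filter av0.
- by move=> v w; rewrite !mem_filter => /andP[? ?] /andP[? ?]; apply: Fcmp.
rewrite mem_filter => /andP[av vU] top.
have {}top w : w \in U -> 0 < a w -> cell_le w v.
  by move=> wU aw; apply: top; rewrite mem_filter aw.
exists v; split=> //; rewrite -[LHS]Fc//.
pose mean j := (\sum_(u <- U) a u)^-1 * \sum_(u <- U) a u * height j u.
have Wlow j (k : R) : \sum_(u <- U) a u * (k - height j u) =
    (\sum_(u <- U) a u) * (k - mean j).
  under eq_bigr do rewrite mulrBr.
  by rewrite sumrB -mulr_suml mulrBr mulrA divff ?gt_eqF// mul1r.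
have Whigh j (k : R) : \sum_(u <- U) a u * (height j u - k) =
    (\sum_(u <- U) a u) * (mean j - k).
  rewrite -[mean j - k]opprB mulrN -Wlow -sumrN.
  by apply: eq_bigr => u _; rewrite -mulrN opprB.
apply: center_eq => j k; rewrite height_barycenter ?gt_eqF// -/(mean j); split.
- move=> yk; rewrite leNgt; apply/negP => kv.
  have : 0 < \sum_(u <- U) a u * (height j u - k%:~R).
    apply: (weighted_sum_gt0 (v := v)) => //; last by rewrite subr_gt0.
    by move=> u uU au; rewrite subr_ge0; apply: (top u uU au j k).2; exact: ltW.
  by rewrite Whigh pmulr_rgt0// subr_gt0 ltNge yk.
- move=> ky; rewrite leNgt; apply/negP => vk.
  have : 0 < \sum_(u <- U) a u * (k%:~R - height j u).
    apply: (weighted_sum_gt0 (v := v)) => //; last by rewrite subr_gt0.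
    by move=> u uU au; rewrite subr_ge0; apply: (top u uU au j k).1; exact: ltW.
  by rewrite Wlow pmulr_rgt0// subr_gt0 ltNge ky.
- move=> vk; rewrite -subr_ge0 -(pmulr_rge0 _ W0) -Wlow weighted_sum_ge0//.
  by move=> u uU au; rewrite subr_ge0; apply: (top u uU au j k).1.
- move=> kv; rewrite -subr_ge0 -(pmulr_rge0 _ W0) -Whigh weighted_sum_ge0//.
  by move=> u uU au; rewrite subr_ge0; apply: (top u uU au j k).2.
Qed.

(** Uniqueness of barycentric coordinates in the union of two flags, in signed
form: [e] is the difference of two families of weights. Its positive and
negative parts have the same total and the same barycenter, so by
[barycenter_top] they would share a top vertex, at which [e] is both positive
and negative. *)
Lemma flag_unique_weights U e :
  flag [set v | v \in U /\ 0 < e v] -> flag [set v | v \in U /\ e v < 0] ->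
  \sum_(v <- U) e v = 0 -> \sum_(v <- U) e v *: v = 0 ->
  forall v, v \in U -> e v = 0.
Proof.
move=> Fp Fn e0 ev0.
pose p v := Num.max (e v) 0; pose n v := Num.max (- e v) 0.
have epn v : e v = p v - n v by rewrite /p /n; case: leP => ?; case: leP => ?; lra.
have p_ge0 v : 0 <= p v by rewrite le_max lexx orbT.
have n_ge0 v : 0 <= n v by rewrite le_max lexx orbT.
have pP v : 0 < p v -> 0 < e v by rewrite lt_max ltxx orbF.
have nP v : 0 < n v -> e v < 0 by rewrite lt_max ltxx orbF oppr_gt0.
have pn : \sum_(v <- U) p v = \sum_(v <- U) n v.
  by apply/subr0_eq; rewrite -sumrB -[RHS]e0; apply: eq_bigr => v _; rewrite epn.
have pnv : \sum_(v <- U) p v *: v = \sum_(v <- U) n v *: v.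
  apply/subr0_eq; rewrite -sumrB -[RHS]ev0; apply: eq_bigr => v _.
  by rewrite -scalerBl -epn.
have [W0|W0] := ltP 0 (\sum_(v <- U) p v); last first.
  have psum0 : \sum_(v <- U) p v = 0.
    by apply/eqP; rewrite eq_le W0 sumr_ge0.
  have nsum0 : \sum_(v <- U) n v = 0 by rewrite -pn.
  have zero (q : L -> R) : (forall v, 0 <= q v) -> \sum_(v <- U) q v = 0 ->
      forall v, v \in U -> q v = 0.
    move=> q0 /eqP; rewrite psumr_eq0// => /allP qs v vU; exact/eqP/qs.
  by move=> v vU; rewrite epn (zero p)// (zero n)// subrr.
have [|v [vU pv vE]] := @barycenter_top U p (fun v _ => p_ge0 v) W0.
  by apply: sub_flag Fp => v /= [? /pP].
have W1 := W0; rewrite pn in W1.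
have [|w [wU nw wE]] := @barycenter_top U n (fun v _ => n_ge0 v) W1.
  by apply: sub_flag Fn => w /= [? /nP].
have vw : v = w by rewrite vE wE pn pnv.
by move: (pP _ pv) (nP _ nw); rewrite vw; lra.
Qed.

(** * The complex of flags *)

Definition flag_complex (X : set L) : set {fset L} :=
  [set s | [/\ s != fset0, flag [set` s] & [set` s] `<=` X]].

(** Weights extended by zero, so that points of two simplices can be compared as
combinations over the union of their vertices. *)
Lemma convex_hull_weights s U x : (s `<=` U)%fset -> convex_hull s x ->
  exists a : L -> R, [/\ forall v, 0 <= a v, forall v, v \notin s -> a v = 0,
    \sum_(v <- U) a v = 1 & x = \sum_(v <- U) a v *: v].
Proof.
move=> sU [a [a0 a1 ->]]; pose a' v := if v \in s then a v else 0.
have a'N v : v \notin s -> a' v = 0 by rewrite /a' => /negbTE ->.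
exists a'; split=> // [v||].
- by rewrite /a'; case: ifPn => // /a0.
- rewrite -(big_fset_incl _ sU) => [|v _ /a'N//].
  by rewrite -a1; apply: eq_big_seq => v vs; rewrite /a' vs.
- rewrite -(big_fset_incl _ sU) => [|v _ /a'N ->]; last by rewrite scale0r.
  by apply: eq_big_seq => v vs; rewrite /a' vs.
Qed.

Lemma weights_convex_hull s U a : (s `<=` U)%fset ->
  (forall v, 0 <= a v) -> (forall v, v \notin s -> a v = 0) ->
  \sum_(v <- U) a v = 1 -> convex_hull s (\sum_(v <- U) a v *: v).
Proof.
move=> sU a0 aN a1; exists a; split=> //.
  by rewrite -a1; apply: big_fset_incl => // v _ /aN.
by apply/esym/big_fset_incl => // v _ /aN ->; rewrite scale0r.
Qed.

Lemma sub_convex_hull s U : (s `<=` U)%fset -> convex_hull s `<=` convex_hull U.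
Proof.
move=> sU x /(convex_hull_weights sU)[a [a0 aN a1 ->]].
by exists a.
Qed.

Lemma simplicial_flag_complex X : simplicial_complex (flag_complex X).
Proof.
split.
- by move=> s [].
- move=> s [_ sF _] e e0 ev0; apply: flag_unique_weights => //.
    by apply: sub_flag sF => v [].
  by apply: sub_flag sF => v [].
- move=> s t [_ sF sX] t0 ts; split=> //.
    by apply: sub_flag sF => v; exact: (fsubsetP ts).
  by move=> v /(fsubsetP ts)/sX.
- move=> s t [_ sF _] [_ tF _]; exists (s `&` t)%fset.
  split; [exact: fsubsetIl|exact: fsubsetIr|apply/seteqP; split=> x]; last first.
    by move=> stx; split; apply: sub_convex_hull stx; rewrite ?fsubsetIl ?fsubsetIr.
  move=> [/(convex_hull_weights (fsubsetUl s t))[a [a0 aN a1 ax]]].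
  move=> /(convex_hull_weights (fsubsetUr s t))[b [b0 bN b1 bx]].
  have ab v : v \in (s `|` t)%fset -> a v - b v = 0.
    apply: (flag_unique_weights (e := fun v => a v - b v)).
    - apply: sub_flag sF => w [_ /=]; apply: contraTT => /aN ->.
      by rewrite sub0r oppr_gt0 -leNgt.
    - apply: sub_flag tF => w [_ /=]; apply: contraTT => /bN ->.
      by rewrite subr0 -leNgt.
    - by rewrite sumrB a1 b1 subrr.
    - by under eq_bigr do rewrite scalerBl; rewrite sumrB -ax -bx subrr.
  rewrite ax; apply: weights_convex_hull => //.
    by apply: fsubset_trans (fsubsetIl _ _) (fsubsetUl _ _).
  move=> v; rewrite inE negb_and => /orP[/aN//|vt].
  have [vs|/aN//] := boolP (v \in s).
  by have := ab v; rewrite inE vs => /(_ isT); rewrite (bN v vt) subr0.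
Qed.

Lemma flag_top s x : flag [set` s] -> convex_hull s x ->
  exists v, [/\ v \in s, cell_le x v & cell_le v x].
Proof.
move=> sF [a [a0 a1 ax]].
have [||v [vs _ vE]] := @barycenter_top s a a0; first by rewrite a1.
  by apply: sub_flag sF => v [].
rewrite a1 invr1 scale1r -ax in vE.
by have [xc cx] := centerP x; exists v; rewrite vs; split=> //; rewrite vE.
Qed.

(** * Covering by flags *)

(** The cardinality of this set replaces the codimension of the cell of [x] as the
quantity that increases from a cell to its proper faces. *)
Definition grid_level x : {set J} :=
  [set j | `[< exists k : int, height j x = k%:~R >]].

Lemma cell_le_int y x j (k : int) : cell_le y x ->
  height j x = k%:~R -> height j y = k%:~R.
Proof.
move=> yx xk; have [h1 h2] := yx j k.
by apply/eqP; rewrite eq_le h1 ?h2// xk.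
Qed.

Lemma grid_levelS x y : cell_le y x -> grid_level x \subset grid_level y.
Proof.
move=> yx; apply/fintype.subsetP => j; rewrite !inE => -[k xk].
by exists k; exact: cell_le_int yx xk.
Qed.

Hypothesis height_inj : forall x y, (forall j, height j x = height j y) -> x = y.

Lemma heightB j x y (t : R) :
  height j (x + t *: (y - x)) = height j x + t * (height j y - height j x).
Proof.
rewrite /height linearD/= linearZ/= linearB/= /GRing.scale/=; ring.
Qed.

(** The exit time is the smallest among those of the single heights; the heights
that agree at [x] and its center are constant along the ray. *)
Lemma exit_point x : center x != x -> exists y (t : R),
  [/\ 1 < t, y = center x + t *: (x - center x), cell_le y x &
    grid_level x \proper grid_level y].
Proof.
move=> /eqP cx; set b := center x in cx *.
have [xb bx] := centerP x; rewrite -/b in xb bx.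
pose D j := height j b != height j x.
have [j0 Dj0] : exists j, D j.
  apply: contrapT => ND; apply: cx; apply: height_inj => j; apply/eqP.
  by apply/negPn/negP => Dj; apply: ND; exists j.
(* [u j] is the time at which the ray reaches a grid hyperplane of [height j]. *)
pose e j := fun u : R => D j ->
  [/\ forall k : int, height j x != k%:~R, 1 < u,
    exists k : int, height j (b + u *: (x - b)) = k%:~R &
    forall t, 1 <= t <= u -> forall k : int,
      (height j x <= k%:~R -> height j (b + t *: (x - b)) <= k%:~R) /\
      (k%:~R <= height j x -> k%:~R <= height j (b + t *: (x - b)))].
have /choice[u uP] j : exists u, e j u.
  have [Dj|NDj] := pselect (D j); last by exists 0.
  have [xN [u u1 [uk ut]]] := line_exit Dj (xb j) (bx j).
  by exists u => _; split=> //; [rewrite heightB|move=> t /ut; rewrite heightB].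
pose j1 := [arg min_(j < j0 | D j) u j]%O.
have [Dj1 j1min] : D j1 /\ forall j, D j -> u j1 <= u j.
  by rewrite /j1; case: arg_minP.
have [xN u1 [k uk] _] := uP j1 Dj1.
have yx : cell_le (b + u j1 *: (x - b)) x.
  move=> j; have [Dj|/negPn/eqP bxj] := boolP (D j).
    have [_ _ _ ut] := uP j Dj; apply: ut.
    by rewrite (ltW u1) j1min.
  by move=> k'; rewrite heightB bxj subrr mulr0 addr0.
exists (b + u j1 *: (x - b)), (u j1); split=> //.
rewrite properE (grid_levelS yx) /=; apply/fintype.subsetPn; exists j1.
  by rewrite !inE; exists k.
by apply/negP; rewrite !inE => -[k' xk']; have := xN k'; rewrite xk' eqxx.
Qed.

(** [x] lies between its center and the exit point, so the center can be added on
top of a flag around the exit point. *)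
Lemma flag_cover x : exists s : {fset L}, [/\ flag [set` s],
  forall v, v \in s -> cell_le v x & convex_hull s x].
Proof.
have [n] := ubnP (#|J| - #|grid_level x|)%N.
elim: n x => // n IH x; rewrite ltnS => xn.
have [cx|cx] := eqVneq (center x) x.
  exists [fset x]%fset; split=> [|v|].
  - by split=> [v|v w] /=; rewrite !inE => /eqP -> // /eqP ->; left.
  - by rewrite inE => /eqP ->.
  - exists (fun=> 1); rewrite !big_seq_fset1 scale1r; split=> //.
have [y [t [t1 yE yx xy]]] := exit_point cx.
have [|s [sF sy [a [a0 a1 ay]]]] := IH y.
  apply: leq_trans xn; apply: ltn_sub2l; last exact: proper_card.
  exact: leq_trans (proper_card xy) (max_card _).
set b := center x in cx yE.
have [xb bx] := centerP x; rewrite -/b in xb bx.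
have bs : b \notin s.
  apply/negP => /sy b_le_y.
  have /grid_levelS yx' := cell_le_trans xb b_le_y.
  by move: xy; rewrite properE yx' andbF.
have t0 : 0 < t by lra.
exists (b |` s)%fset; split.
- split=> [v /=|v w /=]; rewrite !inE.
    by case/predU1P => [->|/sF.1//]; exact/center_eq.
  case/predU1P => [->|vs] /predU1P[->|ws]; first by left.
  + by right; apply: cell_le_trans xb; apply: cell_le_trans (sy _ ws) yx.
  + by left; apply: cell_le_trans xb; apply: cell_le_trans (sy _ vs) yx.
  + exact: sF.2.
- move=> v; rewrite !inE => /predU1P[->//|/sy vy]; exact: cell_le_trans yx.
- exists (fun v => if v == b then 1 - t^-1 else t^-1 * a v).
  have ne v : v \in s -> (v == b) = false by apply: contraTF => /eqP ->.
  split.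
  + move=> v; rewrite !inE; case: eqVneq => /= _.
      by rewrite subr_ge0 invf_le1// ltW.
    by move=> vs; rewrite mulr_ge0 ?a0// invr_ge0 ltW.
  + rewrite big_fsetU1//= eqxx.
    rewrite (eq_big_seq (fun v => t^-1 * a v)) => [|v /ne ->//].
    by rewrite -mulr_sumr a1 mulr1 subrK.
  + rewrite big_fsetU1//= eqxx.
    rewrite (eq_big_seq (fun v => t^-1 *: (a v *: v))) => [|v /ne ->]; last first.
      by rewrite scalerA.
    rewrite -scaler_sumr -ay yE scalerDr scalerA mulVf ?gt_eqF// scale1r.
    by rewrite scalerBl scale1r addrA subrK addrC subrK.
Qed.

(** * Topology of the complex *)

Lemma height_continuous j :
  continuous (fun r : 'rV[R]__ => height j (@r2v R L r)).
Proof.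
have phic := @rV_linear_continuous R _ R^o (phi j \o @r2v R L).
by move=> r; exact: (cvgD (phic r) (cvg_cst (c j))).
Qed.

Lemma cell_le_height y x j : cell_le y x ->
  `|height j y - height j x| <= 1.
Proof.
move=> yx; pose m := Num.floor (height j x).
have [m1 m2] : m%:~R <= height j x /\ height j x <= (m + 1)%:~R.
  by rewrite floor_le ltW// floorD1_gt.
have := (yx j m).2 m1; have := (yx j (m + 1)).1 m2.
move: m1 m2; rewrite intrD ler_distl; lra.
Qed.

Definition box_centers (N : nat) : set L :=
  [set v | center v = v /\ forall j, `|height j v| <= N%:R].

(** Inside the box only the comparisons of the heights with integers between [-N]
and [N] matter, so a center is determined by finitely many bits. *)
Lemma finite_box_centers N : finite_set (box_centers N).
Proof.
(* [k] enumerates the integers from [-N] to [N]. *)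
pose k (i : 'I_(N + N).+1) : int := i%:Z - N%:Z.
pose sig v := [ffun p : J * 'I_(N + N).+1 =>
  (height p.1 v <= (k p.2)%:~R, (k p.2)%:~R <= height p.1 v)].
pose g S := xget 0 [set v | box_centers N v /\ sig v = S].
apply: (@sub_finite_set _ _ (g @` setT)); last first.
  exact/finite_image/finite_finset.
have sig_le v w : box_centers N v -> box_centers N w -> sig v = sig w ->
    cell_le v w.
  move=> [_ vN] [_ wN] vw j z.
  have := vN j; have := wN j; rewrite !ler_norml => /andP[w1 w2] /andP[v1 v2].
  have [zN|zN] := ltP (N%:Z) z.
    have zN' : N%:R < z%:~R :> R by rewrite -(ltr_int R) in zN.
    by split=> h; lra.
  have [Nz|Nz] := ltP z (- N%:Z).
    have Nz' : z%:~R < - N%:R :> R by rewrite -(ltr_int R) mulrNz in Nz.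
    by split=> h; lra.
  have iN : (absz (z + N%:Z)%R < (N + N).+1)%N by lia.
  have := congr1 (fun f : {ffun _} => f (j, Ordinal iN)) vw.
  rewrite !ffunE /=; have -> : k (Ordinal iN) = z by rewrite /k/=; lia.
  by case=> -> ->.
move=> v vB; exists (sig v) => //.
have [gB gv] : box_centers N (g (sig v)) /\ sig (g (sig v)) = sig v.
  by apply: (@xgetPex _ 0 [set u | box_centers N u /\ sig u = sig v]); exists v.
rewrite -gB.1 -[RHS]vB.1; apply: center_eq; exact: sig_le.
Qed.

(** A flag around a point of [X] can be taken below that point, hence inside [X];
the topological condition comes from local finiteness. *)
Lemma triangulation_flag_complex X :
  (forall x y, cell_le y x -> X x -> X y) ->
  triangulation X (flag_complex X).
Proof.
move=> Xdown.
have supp : polyhedron (flag_complex X) = X.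
  apply/seteqP; split=> x.
    move=> [s [_ sF sX] /(flag_top sF)[v [vs xv _]]].
    exact: Xdown xv (sX _ vs).
  move=> Xx; have [s [sF sx xs]] := flag_cover x.
  exists s => //; split=> // [|v /= /sx vx]; last exact: Xdown vx Xx.
  apply/eqP => s0; case: xs => a [_ + _].
  by rewrite s0 big_seq_fset0 => /esym/eqP; rewrite oner_eq0.
split=> [||A AX]; [exact: simplicial_flag_complex|exact: supp|split].
  move=> [C Cc AC] s Ks; exists C => //.
  rewrite AC -setIA; congr (_ `&` _); apply: setIidr.
  by rewrite -supp => x xs; exists s.
move=> Acl; exists A; last exact/esym/setIidl.
have {}Acl s : flag_complex X s ->
    closed (r2v @^-1` (A `&` convex_hull s)).
  move=> /Acl[C Cc ->]; rewrite preimage_setI.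
  by apply: closedI => //; exact: closed_convex_hull.
(* Near a point of the closure, [A] agrees with the closed set [D], the union of
   its traces on the finitely many simplices with vertices in a large box. *)
move=> r rA.
pose h j := height j (r2v r).
pose N := \max_j Num.bound (`|h j| + 2).
have hN j : `|h j| + 2 <= N%:R.
  apply: (@le_trans _ _ (Num.bound (`|h j| + 2))%:R).
    by rewrite ltW// archi_boundP// addr_ge0.
  by rewrite ler_nat; apply: leq_bigmax.
pose F := [set s | flag_complex X s /\ [set` s] `<=` box_centers N].
have finF : finite_set F.
  apply: (@sub_finite_set _ _ [set` fpowerset (fset_set (box_centers N))]).
    move=> s [_ sB]; rewrite /= fpowersetE; apply/fsubsetP => v /sB vB.
    by rewrite in_fset_set ?inE//; exact: finite_box_centers.
  exact: finite_fset.
pose D := \bigcup_(s in F) r2v @^-1` (A `&` convex_hull s).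
have cD : closed D by apply: closed_bigcup => // s [Ks _]; exact: Acl.
suff /cD[s _ []] : closure D r by [].
move=> W Wr.
have Ur : nbhs r [set z : 'rV[R]__ | forall j, `|height j (r2v z) - h j| < 1].
  apply: (@filter_forall _ _
    (fun j (z : 'rV[R]__) => `|height j (r2v z) - h j| < 1) (nbhs r)) => j.
  have := @height_continuous j r; move/cvgr_dist_lt => /(_ 1 ltr01).
  by apply: filterS => z /=; rewrite distrC.
have [y [Ay [Wy Uy]]] := rA _ (filterI Wr Ur).
exists y; split=> //.
have := AX _ Ay; rewrite -supp => -[s Ks ys].
exists s; split=> //.
have [_ sF _] := Ks.
(* All vertices of [s] are comparable with [t], which lies in the cell of [y], so
   their heights differ by at most 1 from those of [y]; together with the radius
   of the neighborhood this accounts for the 2 in [N]. *)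
have [t [ts yt ty]] := flag_top sF ys.
move=> v vs; split; first exact: sF.1.
move=> j; have := Uy j; have := hN j.
have : `|height j v - height j (r2v y)| <= 1.
  have [vt|tv] := sF.2 _ _ vs ts.
    by apply: cell_le_height; exact: cell_le_trans vt ty.
  by rewrite distrC; apply: cell_le_height; exact: cell_le_trans yt tv.
rewrite ler_distl ltr_distl ler_norml.
have : - `|h j| <= h j <= `|h j| by rewrite -ler_norml.
by lra.
Qed.

(** Membership in [A i] passes to faces, so [indices A] decreases along a flag. *)
Lemma good_flag_complex (I : finType) (A : I -> set L) :
  (forall i x y, cell_le y x -> A i x -> A i y) ->
  exists K : set {fset L}, good_triangulation A K.
Proof.
move=> Adown; exists (flag_complex (\bigcup_i A i)); split.
  apply: triangulation_flag_complex => x y yx [i _ Aix].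
  by exists i => //; exact: Adown Aix.
move=> s [_ [_ sF] _].
exists (sort (fun v w => `[< indices A v `<=` indices A w >]) s).
  by rewrite perm_sort.
apply: (@sort_sorted_in _ (mem s)); last exact/allP.
move=> v w vs ws; apply/orP; have [vw|wv] := sF _ _ vs ws; [right|left].
  by apply/asboolP => i; exact: Adown.
by apply/asboolP => i; exact: Adown.
Qed.

End GridCells.

(** * Heights adapted to affine subspaces *)

Lemma coord_vbasis_inj (R : fieldType) (L : vectType R) (x y : L) :
  (forall j, coord (vbasis {:L}) j x = coord (vbasis {:L}) j y) -> x = y.
Proof.
move=> xy; rewrite (coord_vbasis (memvf x)) (coord_vbasis (memvf y)).
by apply: eq_bigr => j _; rewrite xy.
Qed.

Theorem theorem3p10 (R : realType) (L : vectType R) (I : finType)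
    (A : I -> set L) (hA : forall i : I, affine_subspace (A i)) :
  exists K : set {fset L}, good_triangulation A K.
Proof.
have /choice[p /choice[V AE]] := hA.
(* The coordinates of the point itself make the heights separate points; those of
   [(1 - projv V) (x - p)] vanish exactly on [p + V]. *)
pose P o : 'End(L) := if o is Some i then (\1 - projv (V i))%VF else \1%VF.
pose q o : L := if o is Some i then p i else 0.
pose phi (j : option I * 'I_(\dim {:L})) : {linear L -> R^o} :=
  coord (vbasis {:L}) j.2 \o P j.1.
pose c j : R := - phi j (q j.1).
have heightE o j x : height phi c (o, j) x = coord (vbasis {:L}) j (P o (x - q o)).
  by rewrite /height /c -linearB.
have AP i x : A i x <-> forall j, height phi c (Some i, j) x = 0.
  have -> : A i x <-> P (Some i) (x - p i) = 0.
    rewrite AE /= add_lfunE opp_lfunE id_lfunE; split=> [xV|/subr0_eq ->].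
      by rewrite projv_id// subrr.
    exact: memv_proj.
  split=> [x0 j|x0]; first by rewrite heightE x0 linear0.
  by apply: coord_vbasis_inj => j; rewrite -heightE x0 linear0.
apply: (@good_flag_complex _ _ _ phi c) => [x y xy|i x y yx /AP Ax].
  apply: coord_vbasis_inj => j; have := xy (None, j).
  by rewrite !heightE /= !subr0 !id_lfunE.
by apply/AP => j; apply: (cell_le_int (k := 0) yx); exact: Ax.
Qed.
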